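(* Fix a player $i$ of a finite extensive-form game with perfect recall, and consider the following online learner $\mathcal{R}$ over the set $\operatorname{co}\Phi^{(i)}$. It maintains one instance $\mathcal{R}_{\hat I}$ of the CFR algorithm on $Q^{(i)}_{\hat I}$ for each $\hat I\in\mathcal{I}^{(i)}$, and one instance $\mathcal{R}_\Delta$ of regret matching on the simplex $\Delta^{|\mathcal{I}^{(i)}|}$. At each time $t$: it obtains $\vec{\lambda}^t$ from $\mathcal{R}_\Delta$ and $\vec{q}^t_{\hat I}\in Q^{(i)}_{\hat I}$ from each $\mathcal{R}_{\hat I}$, and outputs $\phi^t=\sum_{\hat I}\vec{\lambda}^t[\hat I]\,\phi_{\hat I,\vec{q}^t_{\hat I}}$. Upon observing a linear utility $L^t:\operatorname{co}\Phi^{(i)}\to\mathbb{R}$, it gives each $\mathcal{R}_{\hat I}$ the linear utility $\vec{q}\mapsto L^t(\phi_{\hat I,\vec{q}})-L^t(\phi_{\hat I,\vec{0}})$ and gives $\mathcal{R}_\Delta$ the linear utility $\vec{\lambda}\mapsto\sum_{\hat I}\vec{\lambda}[\hat I]L^t(\phi_{\hat I,\vec{q}^t_{\hat I}})$. Suppose $\max_{\phi,\phi'\in\operatorname{co}\Phi^{(i)}}\{L^t(\phi)-L^t(\phi')\}\le U$ for all $t$. Then the outputs $\phi^1,\ldots,\phi^T$ satisfy $$\max_{\phi^*\in\operatorname{co}\Phi^{(i)}}\sum_{t=1}^T\big(L^t(\phi^* )-L^t(\phi^t)\big)\le 2U|\Sigma^{(i)}|\sqrt{T}.$$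
   Context: Setting: a finite game tree with players $[n]$ and chance; player $i$'s decision nodes are partitioned into information sets $\mathcal{I}^{(i)}$ with action sets $\mathscr{A}(I)$; perfect recall (all nodes of an information set share the same history of player $i$'s own actions). For $I,I'\in\mathcal{I}^{(i)}$, $I\prec I'$ if a root-to-$I'$ path passes through $I$. Sequences $\Sigma^{(i)}=\{(I,a)\}\cup\{\varnothing\}$; $\sigma^{(i)}(I)$ is the last sequence of player $i$ on the path to $I$ ($\varnothing$ if none); $\sigma\succeq I$ means $\sigma=(I',a')$ with $I'=I$ or $I\prec I'$; $\Sigma^{(i)}_I=\{\sigma:\sigma\succeq I\}$. $Q^{(i)}_I\coloneqq\{\vec{q}\in\mathbb{R}^{|\Sigma^{(i)}_I|}_{\ge0}:\sum_{a\in\mathscr{A}(I)}\vec{q}[(I,a)]=1,\ \vec{q}[\sigma^{(i)}(I')]=\sum_{a\in\mathscr{A}(I')}\vec{q}[(I',a)]\ \forall I'\succ I\}$, and $\Pi^{(i)}_I=Q^{(i)}_I\cap\{0,1\}^{|\Sigma^{(i)}_I|}$. For $\hat I\in\mathcal{I}^{(i)}$ and any vector $\vec{y}\in\mathbb{R}^{|\Sigma^{(i)}_{\hat I}|}$, $\phi_{\hat I,\vec{y}}$ is the linear map $\vec{x}\mapsto M\vec{x}$ on $\mathbb{R}^{|\Sigma^{(i)}|}$ with $M[\sigma_r,\sigma_c]=1$ if $\sigma_c\not\succeq\hat I$ and $\sigma_r=\sigma_c$; $M[\sigma_r,\sigma_c]=\vec{y}[\sigma_r]$ if $\sigma_c=\sigma^{(i)}(\hat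 I)$ and $\sigma_r\succeq\hat I$; $0$ otherwise. $\Phi^{(i)}\coloneqq\{\phi_{\hat I,\hat{\vec{\pi}}}:\hat I\in\mathcal{I}^{(i)},\hat{\vec{\pi}}\in\Pi^{(i)}_{\hat I}\}$, and $\operatorname{co}\Phi^{(i)}$ is its convex hull (so $\operatorname{co}\Phi^{(i)}=\{\sum_{\hat I}\vec{\lambda}[\hat I]\phi_{\hat I,\vec{q}_{\hat I}}:\vec{\lambda}\in\Delta^{|\mathcal{I}^{(i)}|},\vec{q}_{\hat I}\in Q^{(i)}_{\hat I}\}$). Regret matching on $\Delta^m$: with cumulative regrets $r^t[j]=\sum_{s<t}(\ell^s(\vec{e}_j)-\ell^s(\vec{x}^s))$, output $\vec{x}^t\propto[r^t]^+$ (uniform if $[r^t]^+=0$). CFR (counterfactual regret minimization, Zinkevich et al. 2008) on a tree-form sequence-form set $Q^{(i)}_I$: runs regret matching locally at each information set on counterfactual utilities and outputs the induced sequence-form strategy. Regret of an online learner on a set $\mathcal{X}$ with linear utilities $\ell^t$: $\max_{x^*\in\mathcal{X}}\sum_t(\ell^t(x^* )-\ell^t(x^t))$. *)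

(* Defs.v *)
From mathcomp Require Import all_boot all_order all_algebra.
Set Implicit Arguments. Unset Strict Implicit. Unset Printing Implicit Defensive.
Import Order.TTheory GRing.Theory Num.Theory.
Local Open Scope ring_scope.

Section Treeplex.
Variables (Info : finType) (Act : Info -> finType).

(* Sigma^(i) = {(I,a)} \cup {empty}; None is the empty sequence. *)
Definition seqT : finType := option {I : Info & Act I}.
Definition mkseq (I : Info) (a : Act I) : seqT := Some (Tagged Act a).

(* parent I = sigma^(i)(I), the last sequence of player i on the path to I.
   (Perfect recall makes this well defined.) *)
Variable parent : Info -> seqT.

Definition pinfo (I : Info) : option Info := omap tag (parent I).
Definition child_rel : rel Info := fun I J => pinfo J == Some I.

Definition info_ge (Ih I : Info) : bool := connect child_rel Ih I.
Definition info_gt (Ih I : Info) : bool := info_ge Ih I && (I != Ih).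
Definition seq_ge (s : seqT) (Ih : Info) : bool :=
  if s is Some p then info_ge Ih (tag p) else false.

Definition tree_wf : Prop :=
  exists depth : Info -> nat,
    forall I J, pinfo I = Some J -> (depth J < depth I)%N.

Variable R : rcfType.
Definition mat := seqT -> seqT -> R.

(* Q^(i)_Ih; vectors in R^{Sigma_Ih} are represented as functions on Sigma
   vanishing outside Sigma_Ih. *)
Definition Qset (Ih : Info) (q : seqT -> R) : Prop :=
  [/\ (forall s, ~~ seq_ge s Ih -> q s = 0),
      (forall s, seq_ge s Ih -> 0 <= q s),
      \sum_(a : Act Ih) q (mkseq a) = 1
    & forall I', info_gt Ih I' -> q (parent I') = \sum_(a : Act I') q (mkseq a)].

Definition Piset (Ih : Info) (q : seqT -> R) : Prop :=
  Qset Ih q /\ (forall s, seq_ge s Ih -> q s = 0 \/ q s = 1).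

Definition phi (Ih : Info) (y : seqT -> R) : mat := fun r c =>
  if ~~ seq_ge c Ih && (r == c) then 1
  else if (c == parent Ih) && seq_ge r Ih then y r else 0.

Definition PhiSet (M : mat) : Prop :=
  exists Ih q, Piset Ih q /\ M = phi Ih q.

Definition conv_hull (S : mat -> Prop) (M : mat) : Prop :=
  exists n (w : 'I_n -> R) (P : 'I_n -> mat),
    [/\ (forall k, 0 <= w k), \sum_k w k = 1, (forall k, S (P k))
      & M = fun r c => \sum_k w k * P k r c].

Definition coPhi : mat -> Prop := conv_hull PhiSet.

Definition lin_util (W : mat) (M : mat) : R := \sum_r \sum_c W r c * M r c.

Definition rm_of (K : finType) (r : K -> R) : K -> R :=
  let z := \sum_k Num.max (r k) 0 in
  if 0 < z then fun k => Num.max (r k) 0 / z else fun _ => #|K|%:R^-1.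

(* us s = coefficient vector of the linear utility at time s (times 0,1,...) *)
Fixpoint rm_cumreg (K : finType) (us : nat -> K -> R) (t : nat) : K -> R :=
  if t is s.+1 then
    let r := rm_cumreg us s in
    fun j => r j + (us s j - \sum_k us s k * rm_of r k)
  else fun _ => 0.

Definition regret_matching (K : finType) (us : nat -> K -> R) (t : nat) : K -> R :=
  rm_of (rm_cumreg us t).

Definition bstrat := forall I : Info, Act I -> R.

Fixpoint cf_val (g : seqT -> R) (b : bstrat) (n : nat) (I : Info) : R :=
  if n is n'.+1 then
    \sum_(a : Act I) b I a *
      (g (mkseq a) + \sum_(J | parent J == mkseq a) cf_val g b n' J)
  else 0.

Definition cf_util (g : seqT -> R) (b : bstrat) (I : Info) (a : Act I) : R :=
  g (mkseq a) + \sum_(J | parent J == mkseq a) cf_val g b #|Info| J.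

Fixpoint cfr_cumreg (gs : nat -> seqT -> R) (t : nat) : bstrat :=
  if t is s.+1 then
    let r := cfr_cumreg gs s in
    let b : bstrat := fun I => @rm_of (Act I) (r I) in
    fun I a => r I a + (@cf_util (gs s) b I a
                        - \sum_(a' : Act I) b I a' * @cf_util (gs s) b I a')
  else fun _ _ => 0.

Definition cfr_behav (gs : nat -> seqT -> R) (t : nat) : bstrat :=
  fun I => @rm_of (Act I) (@cfr_cumreg gs t I).

Fixpoint reach (b : bstrat) (Ih : Info) (n : nat) (I : Info) : R :=
  if I == Ih then 1 else
  if n is n'.+1 then
    (if parent I is Some p then reach b Ih n' (tag p) * b (tag p) (tagged p) else 0)
  else 0.

Definition seqform (b : bstrat) (Ih : Info) : seqT -> R := fun s =>
  if s is Some p then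
    (if info_ge Ih (tag p) then reach b Ih #|Info| (tag p) * b (tag p) (tagged p)
     else 0)
  else 0.

Definition cfr_out (Ih : Info) (gs : nat -> seqT -> R) (t : nat) : seqT -> R :=
  seqform (cfr_behav gs t) Ih.

Definition unitv (s : seqT) : seqT -> R := fun s' => (s' == s)%:R.

(* coefficients of q |-> L^t(phi_{Ih,q}) - L^t(phi_{Ih,0}) on Sigma_Ih *)
Definition cfr_input (Ws : nat -> mat) (Ih : Info) : nat -> seqT -> R :=
  fun t s => if seq_ge s Ih then
    lin_util (Ws t) (phi Ih (unitv s)) - lin_util (Ws t) (phi Ih (fun _ => 0))
  else 0.

Definition q_out (Ws : nat -> mat) (Ih : Info) (t : nat) : seqT -> R :=
  cfr_out Ih (cfr_input Ws Ih) t.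

(* coefficients of lambda |-> sum_Ih lambda[Ih] L^t(phi_{Ih, q^t_Ih}) *)
Definition rmD_input (Ws : nat -> mat) : nat -> Info -> R :=
  fun t Ih => lin_util (Ws t) (phi Ih (q_out Ws Ih t)).

Definition lam_out (Ws : nat -> mat) (t : nat) : Info -> R :=
  regret_matching (rmD_input Ws) t.

Definition learner_out (Ws : nat -> mat) (t : nat) : mat := fun r c =>
  \sum_Ih lam_out Ws t Ih * phi Ih (q_out Ws Ih t) r c.

End Treeplex.

(* Main.v *)
(* The regret against phi_{I,q} is the regret of R_I against q plus the regret of
   R_Delta against the vertex I.  Regret matching on m actions with utilities of
   range U has regret at most U m sqrt T, by the usual quadratic potential
   argument, and the regret of CFR is a sum of local regrets weighted by reach
   probabilities at most 1.  All the utility ranges are at most U: a best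
   response to a linear utility can be taken pure, hence realized in Phi, and the
   value of an information set can be varied on its own by a strategy that plays
   to reach it.  The bound then follows from
   #|Info| + \sum_I #|Act I| <= 2 #|Sigma|. *)
Require Import Defs.
From mathcomp Require Import all_boot all_order all_algebra.
Import Order.TTheory GRing.Theory Num.Theory.
From mathcomp Require Import ring lra.
Set Implicit Arguments. Unset Strict Implicit. Unset Printing Implicit Defensive.
Local Open Scope ring_scope.

(** * Regret matching on a finite set of actions *)

Section RegretMatching.
Variables (R : rcfType) (K : finType).
Implicit Types (r u : K -> R) (us : nat -> K -> R).

Definition distr (x : K -> R) : Prop := (forall k, 0 <= x k) /\ \sum_k x k = 1.

Lemma sum_distr_const (x : K -> R) (c : R) : distr x -> \sum_k x k * c = c.
Proof. by case=> _ x1; rewrite -mulr_suml x1 mul1r. Qed.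

Lemma ler_sum_distr (x u : K -> R) (c : R) :
  distr x -> (forall k, u k <= c) -> \sum_k x k * u k <= c.
Proof.
move=> dx uc; rewrite -[leRHS](sum_distr_const c dx).
by apply: ler_sum => k _; apply: ler_wpM2l => //; case: dx.
Qed.

Lemma rm_of_ext r r' : r =1 r' -> rm_of r =1 rm_of r'.
Proof.
move=> rr' k; rewrite /rm_of (eq_bigr (fun k => Num.max (r' k) 0)).
  by case: ifP => // _; rewrite rr'.
by move=> j _; rewrite rr'.
Qed.

Lemma rm_of_distr r : (0 < #|K|)%N -> distr (rm_of r).
Proof.
move=> K0; have p k : 0 <= Num.max (r k) 0 by rewrite le_max lexx orbT.
rewrite /rm_of; case: ifP => z; split.
- by move=> k; rewrite divr_ge0 // ltW.
- by rewrite -mulr_suml divff // gt_eqF.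
- by move=> k; rewrite invr_ge0 ler0n.
- by rewrite sumr_const cardT -cardE -[_ *+ _]mulr_natl divff // pnatr_eq0 -lt0n.
Qed.

Lemma rm_cumreg_sum us T k : rm_cumreg us T k =
  \sum_(t < T) (us t k - \sum_j us t j * regret_matching us t j).
Proof. by elim: T => [|T IH]; rewrite ?big_ord0 // big_ord_recr /= -IH. Qed.

(* Blackwell's condition: the instantaneous regret is orthogonal to the
   positive part of the cumulative regret. *)
Lemma rm_of_orthogonal r u :
  \sum_k Num.max (r k) 0 * (u k - \sum_j u j * rm_of r j) = 0.
Proof.
have p k : 0 <= Num.max (r k) 0 by rewrite le_max lexx orbT.
rewrite /rm_of; case: ifP => z.
  under eq_bigr do rewrite mulrBr.
  rewrite sumrB -mulr_suml mulr_sumr -sumrB big1 // => k _.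
  by rewrite mulrC; field; rewrite gt_eqF.
have z0 : \sum_k Num.max (r k) 0 = 0.
  by apply/eqP; rewrite eq_le leNgt z /= sumr_ge0.
by rewrite big1 // => k _; rewrite (psumr_eq0P _ z0) ?mul0r.
Qed.

(** The squared positive part of [r + d] is at most the square of [max(r, 0) + d]. On expanding and
    summing over actions, the cross terms vanish by orthogonality, so a round adds at most
    [#|K| * U ^+ 2]. *)
Lemma rm_potential us (U : R) T : (0 < #|K|)%N ->
  (forall t k, (t < T)%N ->
     `|us t k - \sum_j us t j * rm_of (rm_cumreg us t) j| <= U) ->
  \sum_k Num.max (rm_cumreg us T k) 0 ^+ 2 <= T%:R * #|K|%:R * U ^+ 2.
Proof.
move=> K0; elim: T => [|T IH] bd.
  by rewrite !mul0r big1 // => k _; rewrite /= maxxx expr0n.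
have {IH} := IH (fun t k tT => bd t k (ltnW tT)).
set r := rm_cumreg us T => IH /=; rewrite -/r.
pose d k := us T k - \sum_j us T j * rm_of r j.
apply: (@le_trans _ _ (\sum_k
    (Num.max (r k) 0 ^+ 2 + 2 * (Num.max (r k) 0 * d k) + U ^+ 2))).
  apply: ler_sum => k _; rewrite -/(d k).
  have dU : d k ^+ 2 <= U ^+ 2.
    by have := bd T k (ltnSn T); rewrite -/(d k) ler_norml => /andP[? ?]; nra.
  have m0 : 0 <= Num.max (r k) 0 by rewrite le_max lexx orbT.
  have mr : r k <= Num.max (r k) 0 by rewrite le_max lexx.
  move: (Num.max (r k) 0) (d k) m0 mr dU => m e m0 mr dU.
  apply: (@le_trans _ _ ((m + e) ^+ 2)); last first.
    by rewrite sqrrD mulr_natl lerD2l.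
  case: (leP (r k + e) 0) => h; first by rewrite expr0n sqr_ge0.
  by rewrite ler_pXn2r ?nnegrE //; lra.
rewrite !big_split /= -mulr_sumr rm_of_orthogonal mulr0 addr0 sumr_const.
by rewrite -(mulr_natl (U ^+ 2)) -(natr1 T) !mulrDl mul1r lerD2r.
Qed.

(** A single squared coordinate is at most the whole potential. The factor [#|K|] in place of its
    square root comes from [#|K| <= #|K| ^ 2]; it makes the local bounds add up to a count of
    sequences. *)
Lemma rm_bound us (U : R) T k : (0 < #|K|)%N -> 0 <= U ->
  (forall t k, (t < T)%N ->
     `|us t k - \sum_j us t j * rm_of (rm_cumreg us t) j| <= U) ->
  rm_cumreg us T k <= U * #|K|%:R * Num.sqrt T%:R.
Proof.
move=> K0 U0 bd.
have m0 j : 0 <= Num.max (rm_cumreg us T j) 0 by rewrite le_max lexx orbT.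
apply: (@le_trans _ _ (Num.max (rm_cumreg us T k) 0)); first by rewrite le_max lexx.
rewrite -(@ler_pXn2r _ 2) ?nnegrE // ?mulr_ge0 ?sqrtr_ge0 //.
rewrite !exprMn sqr_sqrtr ?ler0n //.
have := rm_potential K0 bd; rewrite (bigD1 k) //= => h.
have s0 : 0 <= \sum_(i | i != k) Num.max (rm_cumreg us T i) 0 ^+ 2.
  by apply: sumr_ge0 => i _; rewrite sqr_ge0.
apply: (@le_trans _ _ (T%:R * #|K|%:R * U ^+ 2)); first by lra.
rewrite [leLHS](_ : _ = U ^+ 2 * #|K|%:R * T%:R); last by ring.
apply: ler_wpM2r; first by [].
apply: ler_wpM2l; first exact: sqr_ge0.
by rewrite expr2 ler_peMl ?ler0n // ler1n.
Qed.

End RegretMatching.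

(** * The order of information sets along the tree *)

Section Tree.
Variables (Info : finType) (Act : Info -> finType) (parent : Info -> seqT Act).
Hypothesis wf : tree_wf parent.
Local Notation ge := (info_ge parent).
Local Notation gt := (info_gt parent).

Lemma info_ge_refl I : ge I I.
Proof. exact: connect0. Qed.

Lemma info_ge_trans I J K : ge I J -> ge J K -> ge I K.
Proof. exact: connect_trans. Qed.

Lemma pinfo_parent I p : parent I = Some p -> pinfo parent I = Some (tag p).
Proof. by rewrite /pinfo => ->. Qed.

Lemma parent_ge I p : parent I = Some p -> ge (tag p) I.
Proof. by move=> e; apply: connect1; rewrite /child_rel (pinfo_parent e). Qed.

Lemma info_geP Ih I :
  reflect (I = Ih \/ exists2 p, parent I = Some p & ge Ih (tag p)) (ge Ih I).
Proof.
apply: (iffP idP) => [|[->|[p e h]]]; last 2 first.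
- exact: info_ge_refl.
- exact: info_ge_trans h (parent_ge e).
case/connectP=> s; case/lastP: s => [_ ->|s J]; first by left.
rewrite rcons_path last_rcons => /andP[ps /eqP eJ ->]; right.
move: eJ; rewrite /pinfo; case: (parent J) => //= p [e].
by exists p => //; rewrite e; apply/connectP; exists s.
Qed.

(** Each parent step strictly lowers the depth, so equal depths force an empty path. Antisymmetry of
    [info_ge] follows. *)
Lemma info_ge_depth : exists depth : Info -> nat,
  forall I J, ge I J -> (depth I <= depth J)%N /\ (depth I = depth J -> I = J).
Proof.
have [depth dP] := wf; exists depth => I J.
have [n] := ubnP (depth J); elim: n J => // n IH J Jn.
case/info_geP=> [->|[p e h]]; first by split.
have lt := dP _ _ (pinfo_parent e).
have [le _] := IH (tag p) (leq_trans lt Jn) h.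
split; first exact: leq_trans le (ltnW lt).
by move=> eq; rewrite -eq ltnNge le in lt.
Qed.

Lemma info_ge_anti I J : ge I J -> ge J I -> I = J.
Proof.
have [depth dP] := info_ge_depth => /dP[le eq] /dP[le' _].
by apply: eq; apply/eqP; rewrite eqn_leq le.
Qed.

Lemma parent_not_ge I p : parent I = Some p -> ~~ ge I (tag p).
Proof.
move=> e; apply/negP => h; have [depth dP] := wf.
have := dP _ _ (pinfo_parent e).
by rewrite -(info_ge_anti h (parent_ge e)) ltnn.
Qed.

(** Climb from [K]: the parent is unique at each step, so both ancestors are met on one path.
    Reaching one of them strictly before the other would put the other above the common parent,
    against [parent_not_ge]. *)
Lemma siblings_disjoint I J K : parent I = parent J -> parent I != None ->
  ge I K -> ge J K -> I = J.
Proof.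
move=> eIJ; case eI: (parent I) => [p|//] _.
have eJ : parent J = Some p by rewrite -eIJ.
have [depth dP] := wf; have [n] := ubnP (depth K).
elim: n K => // n IH K Kn /info_geP[->|[q e hI]] /info_geP[eK|[q' e' hJ]] //.
- by move: e'; rewrite eI => -[qq]; have := parent_not_ge eJ; rewrite qq hJ.
- by subst K; move: e; rewrite eJ => -[qq]; have := parent_not_ge eI; rewrite qq hI.
- move: e'; rewrite e => -[qq]; subst q'.
  exact: IH (leq_trans (dP _ _ (pinfo_parent e)) Kn) hI hJ.
Qed.

Lemma info_gtP Ih I :
  reflect (exists2 p, parent I = Some p & ge Ih (tag p)) (gt Ih I).
Proof.
apply: (iffP andP) => [[/info_geP[->|//]]|[p e h]]; first by rewrite eqxx.
split; first by apply/info_geP; right; exists p.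
by apply: contraTneq h => eI; rewrite -eI parent_not_ge.
Qed.

Lemma info_gtE Ih I : gt Ih I = seq_ge parent (parent I) Ih.
Proof.
apply/info_gtP/idP => [[p -> //]|]; case e: (parent I) => [p|//] h.
by exists p.
Qed.

(** [height] and [level] count strict descendants and strict ancestors. Both are strictly monotone
    along the tree and below [#|Info|], which is why [#|Info|] is enough fuel for [cf_val] and
    [reach]. *)
Definition height I := #|[set J | gt I J]|.
Definition level I := #|[set J | gt J I]|.

Lemma height_ltn I : (height I < #|Info|)%N.
Proof.
rewrite -cardsT; apply: proper_card; apply/properP; split=> //.
by exists I; rewrite ?inE // /info_gt eqxx andbF.
Qed.

Lemma level_ltn I : (level I < #|Info|)%N.
Proof.
rewrite -cardsT; apply: proper_card; apply/properP; split=> //.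
by exists I; rewrite ?inE // /info_gt eqxx andbF.
Qed.

Lemma info_ge_gt_trans I J K : ge I J -> gt J K -> gt I K.
Proof.
move=> IJ /(info_gtP) [p e h]; apply/info_gtP.
by exists p => //; apply: info_ge_trans h.
Qed.

Lemma info_gt_ge_trans I J K : gt I J -> ge J K -> gt I K.
Proof.
move=> /andP[IJ n] JK; rewrite /info_gt (info_ge_trans IJ JK) /=.
by apply: contraNneq n => eK; subst K; rewrite (info_ge_anti IJ JK).
Qed.

Lemma parent_gt J p : parent J = Some p -> gt (tag p) J.
Proof. by move=> e; apply/info_gtP; exists p => //; exact: info_ge_refl. Qed.

Lemma height_gt I J : gt I J -> (height J < height I)%N.
Proof.
move=> IJ; apply: proper_card; apply/properP; split.
  by apply/subsetP=> K; rewrite !inE; apply: info_ge_gt_trans; case/andP: IJ.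
by exists J; rewrite ?inE // /info_gt eqxx andbF.
Qed.

Lemma level_gt I J : gt I J -> (level I < level J)%N.
Proof.
move=> IJ; apply: proper_card; apply/properP; split.
  apply/subsetP=> K; rewrite !inE => KI.
  by apply: info_gt_ge_trans KI _; case/andP: IJ.
by exists I; rewrite ?inE // /info_gt eqxx andbF.
Qed.

Lemma seq_sumE (M : nmodType) (F : seqT Act -> M) : F None = 0 ->
  \sum_s F s = \sum_I \sum_(a : Act I) F (Defs.mkseq a).
Proof.
move=> F0; rewrite (bigD1 None) //= F0 add0r.
rewrite (reindex_omap Some id) /=; last by case.
rewrite (sig_big_dep xpredT (fun _ => xpredT)
  (fun I (a : Act I) => F (Defs.mkseq a))) /=.
by apply: eq_big => [p|[I a] _]; rewrite ?eqxx.
Qed.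

Lemma seq_ge_sumE (M : nmodType) Ih (F : seqT Act -> M) :
  (forall s, ~~ seq_ge parent s Ih -> F s = 0) ->
  \sum_s F s = \sum_(I | ge Ih I) \sum_(a : Act I) F (Defs.mkseq a).
Proof.
move=> F0; rewrite seq_sumE ?F0 // [RHS]big_mkcond /=.
apply: eq_bigr => I _; case: ifPn => // nI.
by rewrite big1 // => a _; rewrite F0.
Qed.

Lemma card_seqT : #|seqT Act| = (\sum_I #|Act I|).+1.
Proof. by rewrite card_option card_tagged sumnE big_map big_enum. Qed.

End Tree.

(** * Counterfactual values, sequence-form strategies and the regret of CFR *)

Section Counterfactual.
Variables (Info : finType) (Act : Info -> finType) (parent : Info -> seqT Act).
Variable R : rcfType.
Hypothesis wf : tree_wf parent.
Hypothesis act0 : forall I, (0 < #|Act I|)%N.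
Local Notation ge := (info_ge parent).
Local Notation gt := (info_gt parent).
Local Notation sq a := (Defs.mkseq a).
Implicit Types (g q : seqT Act -> R) (b : bstrat Act R) (f : forall I, Act I).

Definition behav b : Prop := forall I, distr (b I).

Definition pure f : bstrat Act R := fun I a => (a == f I)%:R.

Lemma pure_sum f I (F : Act I -> R) : \sum_a pure f a * F a = F (f I).
Proof.
rewrite (bigD1 (f I)) //= /pure eqxx mul1r big1 ?addr0 // => a /negbTE ->.
by rewrite mul0r.
Qed.

Lemma behav_pure f : behav (pure f).
Proof.
move=> I; split=> [a|]; first exact: ler0n.
rewrite (eq_bigr (fun a => pure f a * 1)) ?pure_sum // => a _.
by rewrite mulr1.
Qed.

Definition val g b : Info -> R := cf_val parent g b #|Info|.

Lemma cf_val_stable g b n m I :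
  (height parent I < n)%N -> (height parent I < m)%N ->
  cf_val parent g b n I = cf_val parent g b m I.
Proof.
elim: n m I => // n IH [|m] I //; rewrite !ltnS => hn hm /=.
apply: eq_bigr => a _; congr (_ * (_ + _)); apply: eq_bigr => J /eqP e.
have lt := height_gt wf (parent_gt wf e).
by apply: IH; apply: leq_trans lt _.
Qed.

Lemma valE g b I : val g b I = \sum_a b I a * cf_util parent g b a.
Proof.
(* [cf_util] evaluates the children with fuel [#|Info|], so the value at [I] is first rewritten with
   one unit more. *)
rewrite /val (@cf_val_stable _ _ _ #|Info|.+1) ?height_ltn //.
by rewrite ltnS ltnW // height_ltn.
Qed.

Lemma cf_val_local g b b' n I :
  (forall K, ge I K -> b K =1 b' K) ->
  cf_val parent g b n I = cf_val parent g b' n I.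
Proof.
elim: n I => //= n IH I bb'; apply: eq_bigr => a _.
rewrite bb' ?info_ge_refl //; congr (_ * (_ + _)).
apply: eq_bigr => J /eqP e; apply: IH => K JK.
by apply: bb'; apply: info_ge_trans JK; have := parent_ge e.
Qed.

Lemma val_local g b b' I :
  (forall K, ge I K -> b K =1 b' K) -> val g b I = val g b' I.
Proof. exact: cf_val_local. Qed.

Lemma cf_util_local g b b' I (a : Act I) :
  (forall K, gt I K -> b K =1 b' K) ->
  cf_util parent g b a = cf_util parent g b' a.
Proof.
move=> bb'; congr (_ + _); apply: eq_bigr => J /eqP e; apply: cf_val_local.
move=> K JK; apply: bb'.
exact: (info_gt_ge_trans wf (parent_gt wf e) JK).
Qed.

(** Backward induction on height: choosing a maximizing action at each information set, given
    optimal play below, yields one pure strategy that is optimal everywhere at once. *)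
Lemma best_response g : exists f, forall b, behav b -> forall I,
  val g b I <= val g (pure f) I.
Proof.
suff [f fP]: exists f, forall b, behav b -> forall I,
    (height parent I < #|Info|)%N -> val g b I <= val g (pure f) I.
  by exists f => b bb I; apply: fP => //; apply: height_ltn.
(* Only the height bound is generalized; the fuel hidden inside [val] is unchanged. *)
elim: #|Info| => [|n [f fP]].
  have [f _] : exists f : forall I, Act I, forall I : Info, True.
    apply: (@fin_all_exists _ (fun I => Act I) (fun _ _ => True)) => I.
    by have /card_gt0P[a _] := act0 I; exists a.
  by exists f.
have [h hP] : exists h : forall I, Act I, forall I (a : Act I),
    cf_util parent g (pure f) a <= cf_util parent g (pure f) (h I).
  apply: (@fin_all_exists Info (fun I => Act I) 
    (fun I (aI : Act I) => forall a : Act I,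
     cf_util parent g (pure f) a <= cf_util parent g (pure f) aI)) => I.
  have /card_gt0P[a0 _] := act0 I.
  pose F a := cf_util parent g (pure f) (a : Act I).
  by case: (arg_maxP F (isT : xpredT a0)) => a _ aP; exists a => a'; apply: aP.
(* The choices already made below height [n] are kept, and height [n] gets the greedy action against
   them. *)
pose f' I := if (height parent I < n)%N then f I else h I.
have ff' K : (height parent K < n)%N -> @pure f K =1 @pure f' K.
  by move=> hK a; rewrite /pure /f' hK.
exists f' => b bb I; rewrite ltnS => hI.
have fI K : gt I K -> @pure f K =1 @pure f' K.
  by move=> /(height_gt wf) hK; apply: ff'; apply: leq_trans hI.
have [hn|hn] := boolP (height parent I < n)%N.
  rewrite -(@val_local g (pure f) (pure f')); first exact: fP.
  move=> K IK; have [->|nK] := eqVneq K I; first exact: ff'.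
  by apply: fI; rewrite /info_gt IK.
have f'I : f' I = h I by rewrite /f' (negbTE hn).
rewrite !valE pure_sum f'I.
apply: le_trans (_ : cf_util parent g (pure f) (h I) <= _); last first.
  by rewrite (@cf_util_local g (pure f) (pure f')).
apply: ler_sum_distr => // a; apply: le_trans (hP I a).
rewrite lerD2l; apply: ler_sum => J /eqP e; apply: fP => //.
exact: leq_trans (height_gt wf (parent_gt wf e)) hI.
Qed.


(** Comparing tagged pairs avoids a cast from [Act K] to [Act I]. *)
Definition force b I (a : Act I) : bstrat Act R := fun K c =>
  if K == I then (Tagged Act c == Tagged Act a)%:R else b K c.

Lemma forceE b I (a c : Act I) : force b a c = (c == a)%:R.
Proof. by rewrite /force eqxx eq_Tagged. Qed.

Lemma behav_force b I (a : Act I) : behav b -> behav (force b a).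
Proof.
move=> bb K; case: (eqVneq K I) => [->|nK].
  split=> [c|]; first by rewrite forceE ler0n.
  under eq_bigr do rewrite forceE.
  by rewrite (bigD1 a) //= eqxx big1 ?addr0 // => c /negbTE ->.
by have [b0 b1] := bb K; rewrite /force (negbTE nK).
Qed.

Lemma val_force g b I (a : Act I) :
  val g (force b a) I = cf_util parent g b a.
Proof.
rewrite valE; under eq_bigr do rewrite forceE.
rewrite (bigD1 a) //= eqxx mul1r big1 ?addr0 => [|c /negbTE ->]; last first.
  by rewrite mul0r.
apply: cf_util_local => K /andP[_ nK] c.
by rewrite /force (negbTE nK).
Qed.

(* To vary the value at [J] alone, force the action leading to [J] and switch
   strategy only below [J]; this moves the value at the parent just as much. *)
Lemma val_range g (U : R) Ih :
  (forall b b', behav b -> behav b' -> val g b Ih - val g b' Ih <= U) ->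
  forall I, ge Ih I ->
  forall b b', behav b -> behav b' -> val g b I - val g b' I <= U.
Proof.
move=> base I; have [n] := ubnP (level parent I); elim: n I => // n IH J Jn.
case/info_geP=> [->//|[[I a] e IhI]] b b' bb bb'.
have {}IH := IH I (leq_trans (level_gt wf (parent_gt wf e)) Jn) IhI.
pose b2 : bstrat Act R := fun K => if ge J K then b' K else b K.
have bb2 : behav b2 by move=> K; rewrite /b2; case: ifP.
have := IH _ _ (behav_force a bb) (behav_force a bb2).
rewrite !val_force /cf_util opprD addrACA subrr add0r.
rewrite -sumrB (bigD1 J) /=; last by rewrite e.
(* Siblings of [J] cancel: their subtrees are disjoint from that of [J], where alone the two
   strategies differ. *)
rewrite big1 => [|J' /andP[/eqP e' nJ]].
  rewrite addr0 => h; apply: le_trans h; rewrite lerD2l lerN2.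
  rewrite (@cf_val_local g b2 b') // => K JK c.
  by rewrite /b2 JK.
apply/eqP; rewrite subr_eq0; apply/eqP; apply: val_local => K J'K c.
rewrite /b2; case: ifP => // JK.
have eJJ' : J = J' by apply: (siblings_disjoint wf _ _ JK J'K); rewrite e ?e'.
by rewrite eJJ' eqxx in nJ.
Qed.

(** By [val_force], a counterfactual utility is itself a value at [I], so [val_range] applies in
    both directions. *)
Lemma cf_util_range g (U : R) Ih I (a : Act I) b :
  (forall b b', behav b -> behav b' -> val g b Ih - val g b' Ih <= U) ->
  ge Ih I -> behav b -> `|cf_util parent g b a - val g b I| <= U.
Proof.
move=> base IhI bb; have h := val_range base IhI.
rewrite -val_force ler_norml h ?andbT //; last exact: behav_force.
by rewrite lerNl opprB h //; apply: behav_force.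
Qed.

(** By flow conservation the mass at [I] equals one of the nonnegative summands of the mass at its
    parent information set, so mass cannot grow on the way down from [Ih]. *)
Lemma Qset_le1 Ih q I : Qset parent Ih q -> ge Ih I ->
  \sum_(a : Act I) q (sq a) <= 1.
Proof.
case=> q0 qp q1 qf; have [n] := ubnP (level parent I).
elim: n I => // n IH J Jn IhJ.
have [eJ|nJ] := eqVneq J Ih; first by rewrite eJ q1.
have JIh : gt Ih J by rewrite /info_gt IhJ.
case/info_gtP: (JIh) => // -[I a] e IhI; rewrite -qf // e.
have := IH I (leq_trans (level_gt wf (parent_gt wf e)) Jn) IhI.
apply: le_trans; rewrite (bigD1 a) //= lerDl.
by apply: sumr_ge0 => c _; apply: qp.
Qed.

(* Summed over the tree, each [val g b J] enters as the continuation of its parent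
   sequence with weight [q (parent J)] and leaves at [J] with the same weight. *)
Lemma cfr_decomposition g b Ih q : Qset parent Ih q ->
  \sum_s q s * g s - val g b Ih =
  \sum_(I | ge Ih I) \sum_(a : Act I)
    q (sq a) * (cf_util parent g b a - val g b I).
Proof.
case=> q0 qp q1 qf.
have childE : \sum_(I | ge Ih I) \sum_(a : Act I) q (sq a) *
      \sum_(J | parent J == sq a) val g b J =
    \sum_(J | gt Ih J) q (parent J) * val g b J.
  rewrite -(seq_ge_sumE (F := fun s => q s * \sum_(J | parent J == s) val g b J)).
    under eq_bigr do rewrite mulr_sumr.
    rewrite (exchange_big_dep xpredT) //= [RHS]big_mkcond /=.
    apply: eq_bigr => J _.
    rewrite (big_pred1 (parent J)) => [|s]; last exact: eq_sym.
    by rewrite info_gtE //; case: ifPn => // /q0 ->; rewrite mul0r.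
  by move=> s /q0 ->; rewrite mul0r.
have valsE : \sum_(I | ge Ih I) \sum_(a : Act I) q (sq a) * val g b I =
    val g b Ih + \sum_(J | gt Ih J) q (parent J) * val g b J.
  rewrite (bigD1 Ih) ?info_ge_refl //= -mulr_suml q1 mul1r; congr (_ + _).
  by apply: eq_bigr => J JIh; rewrite -mulr_suml qf.
rewrite (seq_ge_sumE (parent := parent) (Ih := Ih)); last first.
  by move=> s /q0 ->; rewrite mul0r.
under [RHS]eq_bigr do under eq_bigr do rewrite mulrBr mulrDr.
under [RHS]eq_bigr do rewrite sumrB big_split /=.
rewrite sumrB big_split /= childE valsE; ring.
Qed.

Lemma reachE b Ih I : reach parent b Ih #|Info| I =
  if I == Ih then 1 else
  if parent I is Some p then
    reach parent b Ih #|Info| (tag p) * b (tag p) (tagged p)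
  else 0.
Proof.
(* Fuel equal to the level suffices: at fuel 0 there is no parent, and the default 0 is the right
   answer unless [J] is [Ih]. *)
have stable n m J : (level parent J <= n)%N -> (level parent J <= m)%N ->
    reach parent b Ih n J = reach parent b Ih m J.
  elim: n m J => [|n IH] [|m] J //= hn hm; case: ifP => // _;
      case e: (parent J) => [p|] //; have lt := level_gt wf (parent_gt wf e).
  - by have := leq_trans lt hn.
  - by have := leq_trans lt hm.
  - by rewrite (IH m) // -ltnS; apply: leq_trans lt _.
have le := ltnW (level_ltn parent I).
by rewrite (stable #|Info| #|Info|.+1 I) // ltnW.
Qed.

Lemma seqform_Qset b Ih : behav b -> Qset parent Ih (seqform parent b Ih).
Proof.
move=> bb; have reach_ge0 n I : 0 <= reach parent b Ih n I.
  elim: n I => [|n IH] I /=; case: ifP => // _; case: (parent I) => // p.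
  by rewrite mulr_ge0 //; case: (bb (tag p)).
have reach_sum I : \sum_(a : Act I) reach parent b Ih #|Info| I * b I a =
    reach parent b Ih #|Info| I.
  by rewrite -mulr_sumr (bb I).2 mulr1.
split=> [[p|] //= /negbTE -> //|[p|] //= ->||].
- by rewrite mulr_ge0 //; case: (bb (tag p)).
- by rewrite /= info_ge_refl reach_sum reachE eqxx.
- move=> I /[dup] /(info_gtP wf)[p e h] /andP[hI nI].
  by rewrite /= hI reach_sum e /= h [RHS]reachE (negbTE nI) e.
Qed.

Lemma seqform_pure f Ih : Piset parent Ih (seqform parent (pure f) Ih).
Proof.
split; first exact/seqform_Qset/behav_pure.
have reach01 n I : reach parent (pure f) Ih n I = 0 \/
    reach parent (pure f) Ih n I = 1.
  elim: n I => [|n IH] I /=; case: ifP => _; try by [left|right].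
  case: (parent I) => [p|]; last by left.
  rewrite /pure; case: eqP => _; last by left; rewrite mulr0.
  by rewrite mulr1; apply: IH.
case=> [p|] //= ->; rewrite /pure; case: eqP => _; last by left; rewrite mulr0.
by rewrite mulr1; apply: reach01.
Qed.

(** Apply the decomposition to the sequence form of [b] itself: its weights at [I] are proportional
    to [b I], and the average of [cf_util] under [b I] is exactly [val], so every local term is
    zero. *)
Lemma dot_seqform g b Ih : behav b ->
  \sum_s seqform parent b Ih s * g s = val g b Ih.
Proof.
move=> bb; apply/eqP; rewrite -subr_eq0; apply/eqP.
rewrite (cfr_decomposition _ b (seqform_Qset Ih bb)) big1 // => I hI /=.
rewrite hI; under eq_bigr do rewrite -mulrA.
rewrite -mulr_sumr; under eq_bigr do rewrite mulrBr.
by rewrite sumrB -valE sum_distr_const // subrr mulr0.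
Qed.

Lemma cfr_behavP (gs : nat -> seqT Act -> R) t : behav (cfr_behav parent gs t).
Proof. by move=> I; apply: rm_of_distr. Qed.

(** CFR updates all information sets jointly; seen from [I] alone, it is regret matching fed with
    the counterfactual utilities that the joint play produces. *)
Lemma cfr_cumregE (gs : nat -> seqT Act -> R) t I (a : Act I) :
  cfr_cumreg parent gs t a =
  rm_cumreg (fun s (c : Act I) =>
    cf_util parent (gs s) (cfr_behav parent gs s) c) t a.
Proof.
elim: t a => //= t IH a; rewrite IH; congr (_ + (_ - _)).
apply: eq_bigr => c _; rewrite mulrC; congr (_ * _).
by apply: rm_of_ext => d; apply: IH.
Qed.

Lemma cfr_bound (gs : nat -> seqT Act -> R) (U : R) T Ih q : 0 <= U ->
  (forall t, (t < T)%N -> forall b b', behav b -> behav b' ->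
     val (gs t) b Ih - val (gs t) b' Ih <= U) ->
  Qset parent Ih q ->
  \sum_(t < T) (\sum_s q s * gs t s - \sum_s cfr_out parent Ih gs t s * gs t s)
    <= U * (\sum_I #|Act I|)%:R * Num.sqrt T%:R.
Proof.
move=> U0 range Qq.
pose us I s (a : Act I) := cf_util parent (gs s) (cfr_behav parent gs s) a.
have usE I s : \sum_j us I s j * rm_of (rm_cumreg (us I) s) j =
    val (gs s) (cfr_behav parent gs s) I.
  rewrite valE; apply: eq_bigr => a _; rewrite mulrC; congr (_ * _).
  by apply: rm_of_ext => c; rewrite cfr_cumregE.
under [leLHS]eq_bigr => t _ do
  rewrite (dot_seqform _ _ (cfr_behavP gs t)) (cfr_decomposition _ _ Qq).
have -> : \sum_(t < T) \sum_(I | ge Ih I) \sum_(a : Act I) q (sq a) *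
      (cf_util parent (gs t) (cfr_behav parent gs t) a -
       val (gs t) (cfr_behav parent gs t) I) =
    \sum_(I | ge Ih I) \sum_(a : Act I) q (sq a) * rm_cumreg (us I) T a.
  rewrite exchange_big /=; apply: eq_bigr => I _.
  rewrite exchange_big /=; apply: eq_bigr => a _.
  rewrite -mulr_sumr rm_cumreg_sum; congr (_ * _).
  by apply: eq_bigr => t _; rewrite usE.
(* The sum is extended to all information sets: those outside the subtree of [Ih] contribute 0 on
   the left and a nonnegative bound on the right. *)
rewrite natr_sum mulr_sumr mulr_suml [leLHS]big_mkcond /=.
apply: ler_sum => I _.
have B0 : 0 <= U * #|Act I|%:R * Num.sqrt T%:R by rewrite !mulr_ge0 ?sqrtr_ge0.
case: ifP => // hI; apply: le_trans (_ : \sum_(a : Act I) q (sq a) *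
    (U * #|Act I|%:R * Num.sqrt T%:R) <= _).
  apply: ler_sum => a _; apply: ler_wpM2l; first by case: Qq => _ qp _ _; apply: qp.
  apply: rm_bound => // t c tT; rewrite usE.
  by apply: (cf_util_range _ (range t tT) hI); apply: cfr_behavP.
by rewrite -mulr_suml ler_piMl // (Qset_le1 Qq).
Qed.

End Counterfactual.

(** * Linear utilities of deviation matrices *)

Section Deviations.
Variables (Info : finType) (Act : Info -> finType) (parent : Info -> seqT Act).
Variable R : rcfType.
Implicit Types (W M : mat Act R) (y : seqT Act -> R).

Lemma lin_util_sum W n (w : 'I_n -> R) (P : 'I_n -> mat Act R) :
  lin_util W (fun r c => \sum_k w k * P k r c) = \sum_k w k * lin_util W (P k).
Proof.
rewrite /lin_util; under [RHS]eq_bigr do rewrite mulr_sumr.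
rewrite [RHS]exchange_big /=; apply: eq_bigr => r _.
under [RHS]eq_bigr do rewrite mulr_sumr.
rewrite [RHS]exchange_big /=; apply: eq_bigr => c _.
by rewrite mulr_sumr; apply: eq_bigr => k _; rewrite mulrCA.
Qed.

(** The map [phi] is affine in [y], which enters only through the column [parent Ih]. The input of
    CFR is therefore that column of the utility. *)
Lemma lin_util_phi W Ih y : lin_util W (phi parent Ih y) =
  lin_util W (phi parent Ih (fun _ => 0)) +
  \sum_(s | seq_ge parent s Ih) y s * W s (parent Ih).
Proof.
rewrite /lin_util [X in _ + X]big_mkcond -big_split /=; apply: eq_bigr => r _.
rewrite -[X in _ + X](_ : \sum_c
    (if (c == parent Ih) && seq_ge parent r Ih then y r * W r c else 0) = _).
  rewrite -big_split; apply: eq_bigr => c _ /=; rewrite /phi.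
  (* On the diagonal branch [r = c] is not below [Ih], so the two nonzero cases of [phi] exclude
     each other and the nested conditional is a sum. *)
  case: ifPn => [/andP[cI /eqP ->]|_].
    by rewrite (negbTE cI) andbF addr0.
  by case: ifP => _; rewrite ?mulr0 ?add0r // mulrC.
rewrite -big_mkcond /=; case: ifP => _.
  by rewrite (big_pred1 (parent Ih)) // => c; rewrite andbT.
by rewrite big_pred0 // => c; rewrite andbF.
Qed.

Lemma cfr_inputE (Ws : nat -> mat Act R) Ih t s : cfr_input parent Ws Ih t s =
  if seq_ge parent s Ih then Ws t s (parent Ih) else 0.
Proof.
rewrite /cfr_input; case: ifP => // hs.
rewrite lin_util_phi addrC addKr (bigD1 s) //= /unitv eqxx mul1r.
by rewrite big1 ?addr0 // => s' /andP[_ /negbTE ->]; rewrite mul0r.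
Qed.

Lemma lin_util_phiB (Ws : nat -> mat Act R) Ih t y y' :
  lin_util (Ws t) (phi parent Ih y) - lin_util (Ws t) (phi parent Ih y') =
  \sum_s y s * cfr_input parent Ws Ih t s -
  \sum_s y' s * cfr_input parent Ws Ih t s.
Proof.
have inputE z : \sum_s z s * cfr_input parent Ws Ih t s =
    \sum_(s | seq_ge parent s Ih) z s * Ws t s (parent Ih).
  rewrite [RHS]big_mkcond; apply: eq_bigr => s _.
  by rewrite cfr_inputE; case: ifP; rewrite ?mulr0.
rewrite !inputE (lin_util_phi _ _ y) (lin_util_phi _ _ y').
by rewrite opprD addrACA subrr add0r.
Qed.

Lemma learner_out_util (Ws : nat -> mat Act R) t :
  lin_util (Ws t) (learner_out parent Ws t) =
  \sum_Ih rmD_input parent Ws t Ih * lam_out parent Ws t Ih.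
Proof.
rewrite /learner_out /rmD_input /lin_util.
under [RHS]eq_bigr do rewrite mulr_suml.
rewrite [RHS]exchange_big /=; apply: eq_bigr => r _.
under [RHS]eq_bigr do rewrite mulr_suml.
rewrite [RHS]exchange_big /=; apply: eq_bigr => c _.
by rewrite mulr_sumr; apply: eq_bigr => k _;
  rewrite -mulrA [_ * lam_out _ _ _ _]mulrC.
Qed.

Hypothesis wf : tree_wf parent.
Hypothesis act0 : forall I, (0 < #|Act I|)%N.

Lemma PhiSet_range W (U : R) :
  (forall M M', coPhi parent M -> coPhi parent M' ->
     lin_util W M - lin_util W M' <= U) ->
  forall M M', PhiSet parent M -> PhiSet parent M' ->
     lin_util W M - lin_util W M' <= U.
Proof.
move=> range M M' hM hM'.
(* [conv_hull] asks for an equality of functions, so the one-term combination stands in for [N];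
   [lin_util] gives both the same value. *)
pose single (N : mat Act R) : mat Act R := fun r c => \sum_(k < 1) 1 * N r c.
have singleE N : lin_util W (single N) = lin_util W N.
  by rewrite (lin_util_sum W (fun _ : 'I_1 => 1) (fun=> N)) big_ord1 mul1r.
have co N : PhiSet parent N -> coPhi parent (single N).
  by move=> hN; exists 1%N, (fun=> 1), (fun=> N); split=> //; rewrite big_ord1.
by rewrite -(singleE M) -(singleE M'); apply: range; apply: co.
Qed.

Variables (Ws : nat -> mat Act R) (U : R) (t : nat).
Hypothesis range : forall M M', PhiSet parent M -> PhiSet parent M' ->
  lin_util (Ws t) M - lin_util (Ws t) M' <= U.

(** Replacing [b] by a pure maximizer and [b'] by a pure minimizer only widens the gap, and pure
    strategies give elements of [PhiSet]. Distinct [I] and [J] serve the simplex learner, equal ones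
    the CFR instances. *)
Lemma phi_behav_range I J b b' : behav b -> behav b' ->
  lin_util (Ws t) (phi parent I (seqform parent b I)) -
  lin_util (Ws t) (phi parent J (seqform parent b' J)) <= U.
Proof.
move=> bb bb'.
have [f fP] := best_response wf act0 (cfr_input parent Ws I t).
(* The minimizer is a best response to the negated utility. *)
have [f' f'P] := best_response wf act0 (fun s => - cfr_input parent Ws J t s).
have {f'P} := f'P _ bb' J.
rewrite -!dot_seqform //; try exact: behav_pure.
under eq_bigr do rewrite mulrN; under [leRHS]eq_bigr do rewrite mulrN.
rewrite !sumrN lerN2 => h'.
have := fP _ bb I; rewrite -!dot_seqform //; last exact: behav_pure.
move=> h.
have pureP f0 K : PhiSet parent (phi parent K (seqform parent (pure R f0) K)).
  by exists K, (seqform parent (pure R f0) K); split=> //; apply: seqform_pure.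
apply: le_trans (range (pureP f I) (pureP f' J)).
by apply: lerB; rewrite -subr_ge0 lin_util_phiB subr_ge0.
Qed.

Lemma cfr_input_range Ih b b' : behav b -> behav b' ->
  val parent (cfr_input parent Ws Ih t) b Ih -
  val parent (cfr_input parent Ws Ih t) b' Ih <= U.
Proof.
move=> bb bb'; have := phi_behav_range Ih Ih bb bb'.
by rewrite lin_util_phiB !dot_seqform.
Qed.

End Deviations.

Theorem theorem2 (Info : finType) (Act : Info -> finType)
  (parent : Info -> seqT Act) (R : rcfType)
  (Ws : nat -> mat Act R) (U : R) (T : nat) :
  tree_wf parent ->
  (forall I, 0 < #|Act I|)%N ->
  (forall t, (t < T)%N -> forall M M' : mat Act R,
      coPhi parent M -> coPhi parent M' ->
      lin_util (Ws t) M - lin_util (Ws t) M' <= U) ->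
  forall Mstar : mat Act R, coPhi parent Mstar ->
  \sum_(t < T) (lin_util (Ws t) Mstar - lin_util (Ws t) (learner_out parent Ws t))
    <= 2 * U * #|seqT Act|%:R * Num.sqrt T%:R.
Proof.
move=> wf act0 coRange Mstar coM.
(* The sign of [U] is read off the range hypothesis at time 0, which is available only when [T] is
   positive. *)
have [->|T0] := posnP T; first by rewrite big_ord0 sqrtr0 mulr0.
have U0 : 0 <= U by have := coRange 0 T0 _ _ coM coM; rewrite subrr.
have range t (tT : (t < T)%N) := PhiSet_range (coRange t tT).
have qE t I : q_out parent Ws I t =
    seqform parent (cfr_behav parent (cfr_input parent Ws I) t) I by [].
have [n [w [P [w0 w1 PhiP ->]]]] := coM.
(* The weights sum to 1, so the regret against [Mstar] is an average of regrets against vertices,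
   and bounding one vertex is enough. *)
under eq_bigr do rewrite lin_util_sum
  -(sum_distr_const (lin_util _ (learner_out _ _ _)) (conj w0 w1)) -sumrB.
under eq_bigr do under eq_bigr do rewrite -mulrBr.
rewrite exchange_big /=; under eq_bigr do rewrite -mulr_sumr.
apply: ler_sum_distr => // k; have [I [q [[Qq _] ->]]] := PhiP k.
have Info0 : (0 < #|Info|)%N by apply/card_gt0P; exists I.
pose S := (\sum_I #|Act I|)%N.
have InfoS : (#|Info| <= S)%N.
  by rewrite -sum1_card; apply: leq_sum => J _; apply: act0.
have cfr_regret : \sum_(t < T) (lin_util (Ws t) (phi parent I q) -
    rmD_input parent Ws t I) <= U * S%:R * Num.sqrt T%:R.
  have := cfr_bound wf act0 U0
    (fun t tT => cfr_input_range wf act0 (range t tT) I) Qq.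
  apply: le_trans; rewrite le_eqVlt; apply/orP; left; apply/eqP.
  apply: eq_bigr => t _.
  by rewrite /rmD_input lin_util_phiB.
have rm_regret : \sum_(t < T) (rmD_input parent Ws t I -
    lin_util (Ws t) (learner_out parent Ws t)) <= U * #|Info|%:R * Num.sqrt T%:R.
  under eq_bigr do rewrite learner_out_util.
  rewrite -rm_cumreg_sum; apply: rm_bound => // t J tT.
  set us := rmD_input parent Ws.
  have lamP : distr (lam_out parent Ws t) by apply: rm_of_distr.
  have usR J1 J2 : us t J1 - us t J2 <= U.
    rewrite /us /rmD_input !qE.
    by apply: (phi_behav_range wf act0 (range t tT)); apply: cfr_behavP.
  rewrite -[X in X - _](sum_distr_const _ lamP).
  have -> : \sum_j us t j * rm_of (rm_cumreg us t) j =
      \sum_j lam_out parent Ws t j * us t j.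
    by apply: eq_bigr => j _; rewrite mulrC.
  (* The instantaneous regret is an average of pairwise differences of utilities, each at most
     [U]. *)
  rewrite -sumrB; under eq_bigr do rewrite -mulrBr.
  rewrite ler_norml ler_sum_distr // andbT lerNl -sumrN.
  by under eq_bigr do rewrite -mulrN opprB; apply: ler_sum_distr.
rewrite (eq_bigr (fun t : 'I_T => (lin_util (Ws t) (phi parent I q) -
    rmD_input parent Ws t I) + (rmD_input parent Ws t I -
    lin_util (Ws t) (learner_out parent Ws t)))) => [|t _]; last first.
  by rewrite addrA subrK.
rewrite big_split /=; apply: le_trans (lerD cfr_regret rm_regret) _.
(* It remains to compare counts: [S + #|Info|] is at most [2 * S], and [#|seqT Act|] is [S.+1]
   because of the empty sequence. *)
rewrite -mulrDl ler_wpM2r ?sqrtr_ge0 // -mulrDr mulrC -mulrA -[2 * (U * _)]mulrCA.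
rewrite mulrC ler_wpM2l // -natrD -natrM ler_nat card_seqT mul2n -addnn.
by rewrite leq_add // ltnW.
Qed.
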